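(* Let $k$ be a positive integer. Let $q_1,q_2,\ldots$ be positive integers such that $q_l\mid q_{l+1}$ and $q_l<q_{l+1}$ for all $l\geq 1$. Suppose that for every $C>0$ there exists $n=n(C)$ such that \[ \frac{\log q_{n+1}}{\log q_n}>C \quad\text{and}\quad \frac{\log q_{n+2}}{\log q_{n+1}}>k+1. \] Set $\zeta=\sum_{l\geq 1} \frac{1}{q_l}$. Then \begin{align*} \lambda_{k,j}(\zeta)&=\frac{1}{j-1}, \qquad 1\leq j\leq k+1,\\ \widehat{\lambda}_{k,1}(\zeta)&=\frac{1}{k},\\ \widehat{\lambda}_{k,j}(\zeta)&=0, \qquad 2\leq j\leq k+1. \end{align*}
   Context: For $\underline{\zeta}=(\zeta_1,\ldots,\zeta_k)\in\mathbb{R}^k$ and $1\leq j\leq k+1$, $\lambda_{k,j}(\underline{\zeta})$ (resp. $\widehat{\lambda}_{k,j}(\underline{\zeta})$) is the supremum of all $\eta\in\mathbb{R}$ such that the system $|x|\leq X$, $\max_{1\leq i\leq k}|\zeta_i x-y_i|\leq X^{-\eta}$ has at least $j$ linearly independent solutions $(x,y_1,\ldots,y_k)\in\mathbb{Z}^{k+1}$ for arbitrarily large real $X$ (resp. for all sufficiently large real $X$). For a real number $\zeta$ one writes $\lambda_{k,j}(\zeta):=\lambda_{k,j}(\zeta,\zeta^2,\ldots,\zeta^k)$ and $\widehat{\lambda}_{k,j}(\zeta):=\widehat{\lambda}_{k,j}(\zeta,\zeta^2,\ldots,\zeta^k)$. Convention: $1/0=\infty$ (so the case $j=1$ of the first line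 reads $\lambda_{k,1}(\zeta)=\infty$). *)

(* Defs.v *)
From HB Require Import structures.
From mathcomp Require Import all_boot all_order all_algebra.
From mathcomp Require Import all_classical all_reals all_analysis.
Set Implicit Arguments. Unset Strict Implicit. Unset Printing Implicit Defensive.
Import Order.TTheory GRing.Theory Num.Theory.
Local Open Scope classical_set_scope.
Local Open Scope ring_scope.

(* The system |x| <= X, max_i |z_i x - y_i| <= X^(-eta) has at least j
   linearly independent integer solutions (x, y_1, ..., y_k) in Z^(k+1).
   The j solutions are the rows (x r, y r 0, ..., y r (k-1)); linear
   independence = the j x (k+1) matrix of these rows has rank j. *)
Definition sol_cond {R : realType} (k j : nat) (z : 'I_k -> R) (X eta : R) : Prop :=
  exists (x : 'I_j -> int) (y : 'I_j -> 'I_k -> int),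
    (forall r : 'I_j, `|((x r)%:~R : R)| <= X /\
       forall i : 'I_k, `|z i * (x r)%:~R - (y r i)%:~R| <= X `^ (- eta))
    /\ \rank (row_mx (\matrix_(r < j, c < 1) ((x r)%:~R : R))
                     (\matrix_(r < j, i < k) ((y r i)%:~R : R))) = j.

Definition lambda_vec {R : realType} (k j : nat) (z : 'I_k -> R) : \bar R :=
  ereal_sup (EFin @` [set eta : R | forall X0 : R, exists X : R,
                         X0 <= X /\ @sol_cond R k j z X eta]).

Definition lambda_hat_vec {R : realType} (k j : nat) (z : 'I_k -> R) : \bar R :=
  ereal_sup (EFin @` [set eta : R | exists X0 : R, forall X : R,
                         X0 <= X -> @sol_cond R k j z X eta]).

Definition powvec {R : realType} (k : nat) (zeta : R) : 'I_k -> R :=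
  fun i => zeta ^+ (i.+1).

Definition lambda {R : realType} (k j : nat) (zeta : R) : \bar R :=
  @lambda_vec R k j (@powvec R k zeta).
Definition lambda_hat {R : realType} (k j : nat) (zeta : R) : \bar R :=
  @lambda_hat_vec R k j (@powvec R k zeta).

Definition zeta_of {R : realType} (q : nat -> nat) : R :=
  limn (fun n : nat => \sum_(1 <= l < n) ((q l)%:R : R)^-1).

(* Main.v *)
(** Put [N = q_n], [M = q_(n+1)], [L = q_(n+2)] for an index [n] at which the gap
    hypothesis holds, [f] for the partial sum of the series up to [1/N] (a
    fraction with denominator [N]) and [g = f + 1/M].  Then [N] is a tiny power
    of [M], and [zeta] is within [2/L], with [L > M^(k+1)], of [g].

    - Expanding [(f + 1/M)^h] binomially and keeping the nonnegative powers of
      [M] in [N^k M^i g^h] gives, for [i = 0, ..., k], independent integer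
      vectors with [x = N^k M^i] and error [O(N^k / M)].  Taking the first [j] of
      them yields [lambda_(k,j) >= 1/(j-1)].  The reverse inequality holds for
      every vector, because a [j x j] minor of [j] solutions is an integer of
      size [O(X^(1 - eta (j-1)))].
    - [lambda_hat_(k,1) >= 1/k] is Dirichlet's theorem.  If [p/q] is [g] in lowest
      terms and [0 < |x| < q^k], the first power [q^h] not dividing [x] makes the
      distance from [x g^h] to the integers at least [1/q]; since [q >= M/N] is
      unbounded, this gives [lambda_hat_(k,1) <= 1/k].
    - For [X] a large fixed power of [N], every solution lies on the line
      spanned by [(1, f, ..., f^k)], so [lambda_hat_(k,2) <= 0]. *)
Require Import Defs.
From HB Require Import structures.
From mathcomp Require Import all_boot all_order all_algebra.
From mathcomp Require Import all_classical all_reals all_analysis.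
From mathcomp Require Import perm ring lra zify.
Set Implicit Arguments.
Unset Strict Implicit.
Unset Printing Implicit Defensive.
Import Order.TTheory GRing.Theory Num.Theory.
Import numFieldNormedType.Exports.
Local Open Scope classical_set_scope.
Local Open Scope ring_scope.

(** * Determinant bounds and the upper bound for [lambda_vec] *)

(** Each term of the Leibniz expansion meets every row and every column exactly once, so all terms
    obey the same bound. *)
Lemma ler_norm_det (R : realDomainType) (n : nat) (A : 'M[R]_n) (a b : 'I_n -> R) :
  (forall i j, `|A i j| <= a i * b j) ->
  `|\det A| <= n`!%:R * (\prod_i a i * \prod_j b j).
Proof.
move=> Aab; rewrite /determinant; apply: (le_trans (ler_norm_sum _ _ _)).
rewrite -card_Sn mulr_natl -sumr_const.
rewrite [leRHS](eq_bigl xpredT); last by move=> s; rewrite inE.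
apply: ler_sum => s _.
rewrite normrM normrX normrN1 expr1n mul1r normr_prod.
rewrite [X in _ <= _ * X](reindex_inj (@perm_inj _ s)) -big_split /=.
by apply: ler_prod => i _; rewrite normr_ge0 Aab.
Qed.

(* The perturbation is a Schur complement of [[1, x], [-u, E]], whose Leibniz
   expansion has no cancelling large terms. *)
Lemma ler_norm_det_rank1 (R : realFieldType) (n : nat) (u x : 'I_n.+1 -> R)
    (E : 'M[R]_n.+1) (X Y Z : R) :
  0 < Y -> Y <= X -> 1 <= Z ->
  (forall i, `|u i| <= Z) -> (forall i, `|x i| <= X) ->
  (forall i j, `|E i j| <= Y) ->
  `|\det (\matrix_(i, j) (u i * x j + E i j))| <= n.+2`!%:R * (Z * (X * Y ^+ n)).
Proof.
move=> Y0 YX Z1 uZ xX EY.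
pose rx : 'rV[R]_n.+1 := \row_j x j; pose cu : 'cV[R]_n.+1 := \col_i u i.
pose B : 'M[R]_(1 + n.+1) := block_mx 1 rx (- cu) E.
have -> : \matrix_(i, j) (u i * x j + E i j) = E + cu *m rx.
  by apply/matrixP => i j; rewrite !mxE big_ord1 !mxE addrC.
have BE : B *m block_mx 1 (- rx) 0 1%:M = block_mx 1 0 (- cu) (E + cu *m rx).
  rewrite mulmx_block !mulmx0 !mulmx1 !mul1mx !addr0.
  by rewrite mulmxN mulNmx opprK addNr addrC.
have detB : \det B = \det (E + cu *m rx).
  have := congr1 determinant BE.
  by rewrite det_mulmx det_ublock det_lblock !det1 !mul1r mulr1.
have X0 : 0 < X by exact: lt_le_trans YX.
(* The weights fit the four blocks of [B]: the corner needs [1 <= X * (Z / Y)], and the weights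
   multiply to [Z * X * Y ^+ n]. *)
pose a (i : 'I_(1 + n.+1)) := if fintype.split i is inl _ then X else Y.
pose b (j : 'I_(1 + n.+1)) := if fintype.split j is inl _ then Z / Y else 1.
rewrite -detB; apply: (le_trans (@ler_norm_det _ _ B a b _)).
  move=> i j; rewrite /a /b -{1}(fintype.splitK i) -{1}(fintype.splitK j).
  case: (fintype.split i) => i'; case: (fintype.split j) => j' /=.
  - rewrite block_mxEul !ord1 mxE normr1 mulrA ler_pdivlMr// mul1r.
    by rewrite (le_trans YX)// ler_peMr// ltW.
  - by rewrite block_mxEur mxE mulr1.
  - rewrite block_mxEdl !mxE normrN [_ * (_ / _)]mulrC divfK//; last by rewrite gt_eqF.
  - by rewrite block_mxEdr mulr1.
rewrite !big_split_ord /= !big_ord1 /a /b.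
have sl i : fintype.split (lshift n.+1 i : 'I_(1 + n.+1)) = inl i by exact: (fintype.unsplitK (inl i)).
have sr i : fintype.split (rshift 1 i : 'I_(1 + n.+1)) = inr i by exact: (fintype.unsplitK (inr i)).
rewrite !sl.
under eq_bigr do rewrite sr.
under [X in _ * (_ * (_ * X))]eq_bigr do rewrite sr.
rewrite !prodr_const card_ord expr1n mulr1 exprS ler_wpM2l// le_eqVlt; apply/orP; left.
by apply/eqP; field; rewrite gt_eqF.
Qed.

Lemma lambda_vec_le (R : realType) (k m : nat) (z : 'I_k -> R) :
  (0 < m)%N -> (lambda_vec m.+1 z <= (m%:R^-1)%:E)%E.
Proof.
move=> m0; apply: ge_ereal_sup => _ [eta /= Heta <-]; rewrite lee_fin.
have mR0 : 0 < m%:R :> R by rewrite ltr0n.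
rewrite leNgt; apply/negP => eta_gt.
have meta : 0 < m%:R * eta - 1.
  by rewrite subr_gt0 mulrC -ltr_pdivrMr// mul1r.
have eta0 : 0 < eta by apply: lt_trans eta_gt; rewrite invr_gt0.
pose Z := 1 + \sum_i `|z i|.
have Z1 : 1 <= Z by rewrite lerDl sumr_ge0.
pose K := m.+2`!%:R * Z.
have K1 : 1 <= K.
  by rewrite -[1]mulr1 ler_pM// ler1n fact_gt0.
(* Chosen so that [ln X >= t] makes [ln K + (1 - m * eta) * ln X] negative, that is
   [K * X * Y ^+ m < 1]. *)
pose t := (ln K + 1) / (m%:R * eta - 1).
have t0 : 0 < t by rewrite divr_gt0// ltr_pwDr// ln_ge0.
have [X [tX]] := Heta (expR t).
have X0 : 0 < X by apply: lt_le_trans tX; rewrite expR_gt0.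
have lnX : t <= ln X by rewrite -[t]expRK ler_ln// posrE expR_gt0.
have lnX0 : 0 < ln X by exact: lt_le_trans lnX.
case=> x [y [sol rk]].
set V := row_mx _ _ in rk.
pose Y := X `^ (- eta).
have Yexp : Y = expR (- eta * ln X) by rewrite /Y /powR gt_eqF.
have full : row_full V^T by rewrite /row_full mxrank_tr rk.
pose f := fullrankfun full.
have := fullrowsub_unit full; rewrite unitmxE unitfE -/f.
pose Vi := row_mx (\matrix_(r < m.+1, c < 1) x r) (\matrix_(r < m.+1, i < k) y r i).
have -> : rowsub f V^T = map_mx intr (rowsub f Vi^T).
  rewrite map_mxsub -map_trmx /V /Vi map_row_mx; congr (rowsub f (row_mx _ _)^T);
  by apply/matrixP => i j; rewrite !mxE.
rewrite det_map_mx intr_eq0 => det0.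
have : 1 <= `|(\det (rowsub f Vi^T))%:~R : R|.
  by rewrite -intr_norm ler1z -gtz0_ge1 normr_gt0.
rewrite -det_map_mx leNgt => /negP; apply.
(* The nonzero minor may use any coordinates: [x] has coefficient 1 and no error, while [y c] lies
   within [Y] of [z c * x]. *)
pose u (i : 'I_m.+1) := if fintype.split (f i) is inr c then z c else 1.
pose E := \matrix_(i, j) ((map_mx intr (rowsub f Vi^T)) i j - u i * (x j)%:~R) : 'M[R]_m.+1.
have -> : map_mx intr (rowsub f Vi^T) = \matrix_(i, j) (u i * (x j)%:~R + E i j).
  by apply/matrixP => i j; rewrite [RHS]mxE [E i j]mxE addrC subrK.
have YX : Y <= X.
  rewrite Yexp -[leRHS](@lnK _ X)// ler_expR -[leRHS]mul1r ler_wpM2r//; last lra.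
  exact: ltW.
apply: (@le_lt_trans _ _ (m.+2`!%:R * (Z * (X * Y ^+ m)))).
  apply: ler_norm_det_rank1 => //.
  - by rewrite Yexp expR_gt0.
  - move=> i; rewrite /u; case: fintype.split => c; rewrite ?normr1//.
    rewrite /Z (bigD1 c)//= addrCA lerDl addr_ge0// sumr_ge0//.
  - by move=> i; have [] := sol i.
  - move=> i j; rewrite !mxE /u.
    case: (fintype.split (f i)) => c; rewrite !mxE.
      by rewrite mul1r subrr normr0 Yexp expR_ge0.
    by rewrite distrC; have [_] := sol j; apply.
rewrite mulrA -/K -[K](@lnK _ K) ?posrE ?(lt_le_trans _ K1)//.
rewrite -[X](@lnK _ X)// Yexp -expRM_natl -!expRD -[ltRHS]expR0 ltr_expR.
have : t * (m%:R * eta - 1) <= ln X * (m%:R * eta - 1) by rewrite ler_wpM2r// ltW.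
by rewrite divfK ?gt_eqF//; lra.
Qed.

(** * Truncated binomial expansions and the lower bound for [lambda] *)

(* [N], [M], [L] play the roles of three consecutive denominators [q_n],
   [q_(n+1)], [q_(n+2)], and [P / N] is the partial sum up to [1 / q_n]. *)
Definition gap_approximable (R : realType) (k : nat) (zeta : R) :=
  forall C : nat, exists N M L P : nat,
    [/\ (1 < N)%N, (N %| M)%N, (N ^ C < M)%N, (M ^ k.+1 < L)%N &
      P%:R / N%:R + M%:R^-1 <= zeta <= P%:R / N%:R + M%:R^-1 + 2 / L%:R].

(** A crude mean value estimate with a constant free of [h], so that all coordinates of the power
    vector share one bound. *)
Lemma subrXX_le (R : realDomainType) (a b : R) (h k : nat) :
  0 <= a -> a <= b -> b <= 2 -> (h <= k)%N ->
  b ^+ h - a ^+ h <= k%:R * 2 ^+ k * (b - a).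
Proof.
move=> a0 ab b2 hk.
suff: b ^+ h - a ^+ h <= h%:R * 2 ^+ h * (b - a).
  move=> /le_trans; apply; apply: ler_wpM2r; first by rewrite subr_ge0.
  by apply: ler_pM; rewrite ?ler_nat ?ler0n ?exprn_ge0 ?ler_eXn2l// ltr1n.
elim: h {k hk} => [|h IH]; first by rewrite !expr0 subrr mul0r mul0r.
have a2 : a ^+ h <= 2 ^+ h by apply: lerXn2r; rewrite ?nnegrE ?(le_trans ab).
have -> : b ^+ h.+1 - a ^+ h.+1 = b * (b ^+ h - a ^+ h) + a ^+ h * (b - a).
  by rewrite !exprS; ring.
have /(ler_wpM2r _) : a ^+ h <= 2 ^+ h.+1.
  by apply: (le_trans a2); rewrite ler_eXn2l// ltr1n.
move=> /(_ (b - a)); rewrite subr_ge0 => /(_ ab) H1.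
have H2 : b * (b ^+ h - a ^+ h) <= 2 * (h%:R * 2 ^+ h * (b - a)).
  apply: ler_pM => //; first exact: le_trans ab.
  by rewrite subr_ge0; apply: lerXn2r; rewrite ?nnegrE// (le_trans a0).
apply: (le_trans (lerD H2 H1)).
by rewrite -natr1 exprS le_eqVlt; apply/orP; left; apply/eqP; ring.
Qed.

Lemma exprDn_widen (R : comNzRingType) (x y : R) (h k : nat) : (h <= k)%N ->
  (x + y) ^+ h = \sum_(a < k.+1) 'C(h, a)%:R * x ^+ (h - a) * y ^+ a.
Proof.
move=> hk; rewrite exprDn.
rewrite (big_ord_widen k.+1 (fun a => (x ^+ (h - a) * y ^+ a) *+ 'C(h, a)))//.
rewrite big_mkcond /=; apply: eq_bigr => a _.
rewrite -mulrA mulr_natl; case: ifP => // /negbT; rewrite -leqNgt => ha.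
by rewrite bin_small// mulr0n.
Qed.

(* The [h]-th coordinate of [N^k M^i (1, g, ..., g^k)], [g = P/N + 1/M], with
   the terms of negative degree in [M] dropped from its expansion. *)
Definition jet (k N M P i h : nat) : nat :=
  \sum_(a < i.+1) 'C(h, a) * P ^ (h - a) * N ^ (k - (h - a)) * M ^ (i - a).

(** The summand splits into a factor in [(i, a)] and a factor in [(a, h)], a matrix product. The
    free range [m] is [k.+1] for the error bound and [j] for the rank. *)
Lemma jetE (R : realType) (k N M P i h m : nat) :
  (0 < N)%N -> (i < m)%N -> (h <= k)%N ->
  (jet k N M P i h)%:R = \sum_(a < m)
     (if (a <= i)%N then N%:R ^+ k * M%:R ^+ (i - a) else 0) *
     ('C(h, a)%:R * (P%:R / N%:R) ^+ (h - a)) :> R.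
Proof.
move=> N0 im hk; rewrite /jet natr_sum.
rewrite (big_ord_widen m (fun a => ('C(h, a) * P ^ (h - a) * N ^ (k - (h - a)) * M ^ (i - a))%N%:R : R))//.
rewrite big_mkcond /=; apply: eq_bigr => a _; rewrite ltnS.
case: ifP => _; last by rewrite mul0r.
rewrite !natrM !natrX expr_div_n.
have NR : N%:R != 0 :> R by rewrite pnatr_eq0 -lt0n.
rewrite -{2}(@subnK (h - a) k) ?exprD; last exact: leq_trans (leq_subr _ _) hk.
by field; rewrite expf_neq0.
Qed.

Lemma jet0 (k N M P i : nat) : jet k N M P i 0 = (N ^ k * M ^ i)%N.
Proof.
by rewrite /jet big_ord_recl /= bin0 !sub0n expn0 !subn0 !mul1n big1 ?addn0.
Qed.

(** There are two sources of error. Replacing [zeta] by [g] costs a multiple of [N^k M^i / L], at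
    most [N^k / M] since [L > M^(k+1)]; the dropped terms all carry a negative power of [M]. *)
Lemma jet_error (R : realType) (zeta : R) (k N M L P i h : nat) :
  (0 < N)%N -> (0 < M)%N -> (M ^ k.+1 < L)%N -> (i <= k)%N -> (h <= k)%N ->
  P%:R / N%:R + M%:R^-1 <= zeta <= P%:R / N%:R + M%:R^-1 + 2 / L%:R ->
  zeta <= 2 ->
  `|zeta ^+ h * (N ^ k * M ^ i)%:R - (jet k N M P i h)%:R|
    <= (2 * (k%:R * 2 ^+ k) + 3 ^+ k) * (N%:R ^+ k / M%:R).
Proof.
move=> N0 M0 ML ik hk /andP[gz zg] z2.
set f := P%:R / N%:R in gz zg *; set g := f + _ in gz zg.
have M0R : 0 < M%:R :> R by rewrite ltr0n.
have L0R : 0 < L%:R :> R by rewrite ltr0n (leq_ltn_trans _ ML).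
have f0 : 0 <= f by rewrite divr_ge0.
have iM0 : 0 <= M%:R^-1 :> R by rewrite invr_ge0 ltW.
have g0 : 0 <= g by rewrite addr_ge0.
have f2 : f <= 2 by apply: le_trans z2; apply: le_trans gz; rewrite lerDl.
have Nk0 : 0 <= N%:R ^+ k :> R by rewrite exprn_ge0.
set x : R := _%:R; have xE : x = N%:R ^+ k * M%:R ^+ i by rewrite /x natrM !natrX.
have x0 : 0 <= x by rewrite ler0n.
have -> : zeta ^+ h * x - (jet k N M P i h)%:R =
  x * (zeta ^+ h - g ^+ h) + (x * g ^+ h - (jet k N M P i h)%:R) by ring.
apply: (le_trans (ler_normD _ _)); rewrite mulrDl; apply: lerD.
  rewrite normrM (ger0_norm x0) ger0_norm; last first.
    by rewrite subr_ge0; apply: lerXn2r; rewrite ?nnegrE// (le_trans g0).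
  apply: (@le_trans _ _ (x * (k%:R * 2 ^+ k * (2 / L%:R)))).
    apply: ler_wpM2l => //; apply: (le_trans (subrXX_le g0 gz z2 hk)).
    by apply: ler_wpM2l; rewrite ?mulr_ge0 ?exprn_ge0// lerBlDl.
  rewrite [leLHS](_ : _ = 2 * (k%:R * 2 ^+ k) * (x / L%:R)); last by ring.
  apply: ler_wpM2l; first by rewrite !mulr_ge0 ?exprn_ge0.
  rewrite xE -mulrA; apply: ler_wpM2l => //.
  rewrite ler_pdivrMr// mulrC ler_pdivlMr// -exprSr -natrX ler_nat.
  by apply: leq_trans (ltnW ML); rewrite leq_pexp2l.
rewrite xE (exprDn_widen _ _ hk) (jetE R M P N0 (_ : i < k.+1)%N hk)// -/f.
rewrite mulr_sumr -sumrB.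
apply: (le_trans (ler_norm_sum _ _ _)).
(* Once [N^k / M] is factored out, the majorant is the expansion of [(f + 1)^h], at most [3^k]; the
   factor [1 ^+ a] keeps its binomial shape. *)
apply: (@le_trans _ _ (\sum_(a < k.+1) N%:R ^+ k / M%:R * ('C(h, a)%:R * f ^+ (h - a) * 1 ^+ a))).
  apply: ler_sum => a _; rewrite expr1n mulr1.
  set T := 'C(h, a)%:R * f ^+ (h - a).
  have T0 : 0 <= T by rewrite mulr_ge0 ?exprn_ge0.
  case: leqP => ai.
    have MME : M%:R ^+ i * M%:R^-1 ^+ a = M%:R ^+ (i - a) :> R.
      by rewrite -{1}(subnK ai) exprD exprVn mulfK// expf_neq0// gt_eqF.
    rewrite -/T -mulrA [_ * M%:R^-1 ^+ a]mulrC mulrA -mulrA -MME.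
    rewrite [X in `|X|](_ : _ = 0); last by rewrite /T; ring.
    by rewrite normr0; apply: mulr_ge0 => //; exact: mulr_ge0.
  rewrite mul0r subr0 ger0_norm; last by rewrite !mulr_ge0 ?exprn_ge0.
  rewrite [leLHS](_ : _ = N%:R ^+ k * (M%:R ^+ i * M%:R^-1 ^+ a) * T); last by ring.
  apply: ler_wpM2r => //; apply: ler_wpM2l => //.
  rewrite -(subnK ai) addnS addnC -addnS exprD mulrA -exprMn divff ?gt_eqF//.
  rewrite expr1n mul1r exprS ler_piMr// exprn_ile1//.
  by rewrite invf_le1// ler1n.
rewrite -mulr_sumr -(exprDn_widen _ _ hk) mulrC; apply: ler_wpM2r.
  by rewrite mulr_ge0.
apply: (@le_trans _ _ (3 ^+ h)).
  by apply: lerXn2r; rewrite ?nnegrE//; lra.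
by rewrite ler_eXn2l// ltr1n.
Qed.

Lemma mxrank_colsub_unit (F : fieldType) (m n : nat) (g : 'I_m -> 'I_n)
    (V : 'M[F]_(m, n)) : colsub g V \in unitmx -> \rank V = m.
Proof.
move=> gV; apply/eqP; rewrite eqn_leq rank_leq_row /= -{1}(mxrank_unit gV).
rewrite (_ : colsub g V = V *m colsub g 1%:M) ?mxrankM_maxl//.
by rewrite mulmx_colsub mulmx1.
Qed.

(** The first [j] columns factor as a lower triangular matrix with diagonal [N^k] times an upper
    triangular one with unit diagonal. *)
Lemma rank_jet (R : realType) (k N M P j : nat) :
  (0 < N)%N -> (j <= k.+1)%N ->
  \rank (row_mx (\matrix_(r < j, c < 1) ((N ^ k * M ^ r)%N%:Z%:~R : R))
                (\matrix_(r < j, i < k) ((jet k N M P r i.+1)%:Z%:~R : R))) = j.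
Proof.
move=> N0 jk; set V := row_mx _ _.
have VE : V = \matrix_(r < j, c < 1 + k) (jet k N M P r c)%:R.
  apply/matrixP => r c; rewrite !mxE; case: fintype.splitP => c' ->; rewrite !mxE.
    by rewrite ord1 jet0.
  by rewrite add1n.
pose g : 'I_j -> 'I_(1 + k) := widen_ord jk.
pose T := \matrix_(r < j, a < j) (if (a <= r)%N then N%:R ^+ k * M%:R ^+ (r - a) else 0) : 'M[R]_j.
pose D := \matrix_(a < j, c < j) ('C(c, a)%:R * (P%:R / N%:R) ^+ (c - a)) : 'M[R]_j.
have TD : colsub g V = T *m D.
  apply/matrixP => r c; rewrite VE !mxE (jetE R M P N0 (ltn_ord r)).
    by apply: eq_bigr => a _; rewrite !mxE.
  by rewrite -ltnS (leq_trans (ltn_ord c) jk).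
have Tu : T \in unitmx.
  rewrite unitmxE det_trig.
    rewrite unitfE; apply/prodf_neq0 => i _.
    by rewrite mxE leqnn subnn expr0 mulr1 expf_neq0// pnatr_eq0 -lt0n.
  by apply/is_trig_mxP => i a ia; rewrite mxE leqNgt ia.
have Du : D \in unitmx.
  rewrite unitmxE -det_tr det_trig.
    rewrite unitfE; apply/prodf_neq0 => i _.
    by rewrite !mxE binn subnn expr0 mulr1 oner_eq0.
  by apply/is_trig_mxP => i a ia; rewrite !mxE bin_small// mul0r.
by apply: (@mxrank_colsub_unit _ _ _ g); rewrite TD unitmx_mul Tu Du.
Qed.

Lemma powR_expR (R : realType) (x y : R) : 0 < x -> x `^ y = expR (y * ln x).
Proof. by move=> x0; rewrite /powR gt_eqF. Qed.

Lemma sol_cond_jet (R : realType) (k i : nat) (zeta eta X0 : R) :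
  zeta <= 2 -> gap_approximable k zeta ->
  (i <= k)%N -> 0 <= eta -> eta * i%:R < 1 ->
  exists X : R, X0 <= X /\ sol_cond i.+1 (powvec (k:=k) zeta) X eta.
Proof.
move=> z2 gap ik eta0 etai.
pose K : R := 2 * (k%:R * 2 ^+ k) + 3 ^+ k.
have K0 : 0 < K by rewrite ltr_wpDl ?exprn_gt0// !mulr_ge0 ?exprn_ge0.
(* The factor [X1] in [X] only secures [X0 <= X]: for [i = 0] nothing else does, as [N] need not be
   large. *)
pose X1 := (Num.truncn X0).+1.
have X01 : X0 <= X1%:R by rewrite ltW// truncnS_gt.
pose C1 := Num.bound K.
have KC1 : K < 2 ^+ C1 by apply: upper_nthrootP.
pose d := 1 - eta * i%:R; have d0 : 0 < d by rewrite subr_gt0.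
(* With [a = ln N] and [b = ln M], and [ln K], [ln X1] bounded by [C1 * a], [X1 * a] (as [N >= 2]),
   the required estimate follows from [s * a <= d * b]. Since [b >= C * a], it is enough that
   [C >= s / d]. *)
pose s := C1%:R + k%:R + eta * (X1%:R + k%:R).
pose C := (Num.truncn (s / d)).+1.
have sC : s <= C%:R * d by rewrite -ler_pdivrMr// ltW// truncnS_gt.
have [N [M [L [P [N1 _ NM ML gz]]]]] := gap C.
have N0 : (0 < N)%N by exact: ltnW.
have M0 : (0 < M)%N by exact: leq_ltn_trans NM.
exists (X1 * (N ^ k * M ^ i))%:R; split.
  apply: (le_trans X01); rewrite ler_nat leq_pmulr// muln_gt0 !expn_gt0.
  by rewrite N0 M0.
have key : K * (N%:R ^+ k / M%:R) <= (X1 * (N ^ k * M ^ i))%:R `^ (- eta) :> R.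
  have NR : 0 < N%:R :> R by rewrite ltr0n.
  have MR : 0 < M%:R :> R by rewrite ltr0n.
  have X1R : 0 < X1%:R :> R by rewrite ltr0n.
  have l2 : 0 < ln 2 :> R by rewrite ln_gt0// ltr1n.
  have l2N : ln 2 <= ln N%:R :> R by rewrite ler_ln ?posrE// ler_nat.
  set a := ln N%:R in l2N; pose b : R := ln M%:R.
  have lnK1 : ln K <= C1%:R * a.
    apply: (@le_trans _ _ (ln (2 ^+ C1))).
      by rewrite ler_ln ?posrE ?exprn_gt0// ltW.
    by rewrite lnXn// -[leLHS]mulr_natl ler_wpM2l.
  have lnX1 : ln X1%:R <= X1%:R * a.
    apply: (@le_trans _ _ (ln (2 ^+ X1))).
      by rewrite ler_ln ?posrE ?exprn_gt0// -natrX ler_nat ltnW// ltn_expl.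
    by rewrite lnXn// -[leLHS]mulr_natl ler_wpM2l.
  have ab : C%:R * a <= b.
    rewrite mulr_natl -lnXn// ler_ln ?posrE ?exprn_gt0// -natrX ler_nat.
    exact: ltnW.
  rewrite !natrM !natrX powR_expR ?mulr_gt0 ?exprn_gt0//.
  rewrite !lnM ?posrE ?mulr_gt0 ?exprn_gt0// !lnXn//.
  rewrite -[K](@lnK _ K)// -[N%:R ^+ k](@lnK _ (N%:R ^+ k)) ?posrE ?exprn_gt0//.
  rewrite -[in M%:R^-1](@lnK _ M%:R)// -expRN -!expRD ler_expR lnXn//.
  rewrite -[_ *+ k]mulr_natl -[_ *+ i]mulr_natl -/a -/b.
  have H1 : s * a <= d * b.
    apply: (@le_trans _ _ (C%:R * d * a)); first by apply: ler_wpM2r => //; lra.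
    by rewrite mulrAC mulrC; apply: ler_wpM2l => //; exact: ltW.
  have H2 : eta * ln X1%:R <= eta * (X1%:R * a) by exact: ler_wpM2l.
  by move: H1 H2; rewrite /s /d; lra.
exists (fun r => (N ^ k * M ^ r)%N%:Z), (fun r c => (jet k N M P r c.+1)%:Z).
split; last exact: rank_jet.
move=> r; have ri : (r <= i)%N by rewrite -ltnS.
split.
  rewrite ger0_norm; last by rewrite ler0n.
  rewrite ler_nat; apply: leq_trans (leq_pmull _ _) => //.
  by rewrite leq_mul2l leq_pexp2l// orbT.
move=> c; apply: le_trans key.
by apply: (jet_error N0 M0 ML) => //; exact: leq_trans ik.
Qed.

(** * Dirichlet's theorem and the lower bound for the first uniform exponent *)

(** Lets an exponent be tested strictly below the claimed value, where constants can be absorbed;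
    the floor [b] keeps the tested values nonnegative. *)
Lemma lee_fin_lt (R : realType) (b x : R) (S : \bar R) : b < x ->
  (forall e, b <= e < x -> (e%:E <= S)%E) -> (x%:E <= S)%E.
Proof.
move=> bx H; apply/lee_addgt0Pr => e e0; rewrite -leeBlDr// -EFinB.
have [xe|xe] := leP b (x - e).
  by apply: H; rewrite xe gtrBl.
by apply: le_trans (H b _); rewrite ?lexx// lee_fin ltW.
Qed.

(** Pigeonhole: the multiples [0, ..., n] of [z] modulo 1 fall into [T^k] cubes of side [1 / T], so
    two of them share a cube. *)
Lemma dirichlet_approximation (R : realType) (k T n : nat) (z : 'I_k -> R) :
  (0 < T)%N -> (T ^ k <= n)%N ->
  exists (x : nat) (y : 'I_k -> int), [/\ (0 < x)%N, (x <= n)%N &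
    forall i, `|z i * x%:R - (y i)%:~R| <= T%:R^-1].
Proof.
case: T => // T _ Tn.
pose fr (t : R) : R := t - (Num.floor t)%:~R.
have fr0 t : 0 <= fr t by rewrite subr_ge0 floor_le_tmp.
have fr1 t : fr t < 1 by rewrite ltrBlDl -[1]/(1%:~R) -intrD floorD1_gt.
have TR : 0 < T.+1%:R :> R by rewrite ltr0n.
pose cell t := Num.truncn (T.+1%:R * fr t).
have cellT t : (cell t < T.+1)%N.
  by rewrite truncn_lt_nat ?mulr_ge0// gtr_pMr.
pose F (x : 'I_n.+1) : {ffun 'I_k -> 'I_T.+1} := [ffun i => inord (cell (z i * x%:R))].
have /injectivePn[x1 [x2 x12 Fx]] : ~~ injectiveb F.
  apply/negP => /injectiveP /leq_card.
  by rewrite card_ffun !card_ord leqNgt ltnS Tn.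
wlog lt12 : x1 x2 x12 Fx / (x1 < x2)%N.
  move=> W; have := x12; rewrite neq_ltn => /orP[lt|lt]; first exact: W lt.
  by apply: W lt; rewrite // eq_sym.
exists (x2 - x1)%N, (fun i => Num.floor (z i * x2%:R) - Num.floor (z i * x1%:R)).
split; first by rewrite subn_gt0.
  by rewrite (leq_trans (leq_subr _ _))// -ltnS.
move=> i; rewrite natrB; last exact: ltnW.
have cE : cell (z i * x1%:R) = cell (z i * x2%:R).
  have := congr1 (fun G : {ffun 'I_k -> 'I_T.+1} => val (G i)) Fx.
  by rewrite /F !ffunE /= !inordK.
have -> : z i * (x2%:R - x1%:R) -
    (Num.floor (z i * x2%:R) - Num.floor (z i * x1%:R))%:~R =
    fr (z i * x2%:R) - fr (z i * x1%:R).
  by rewrite intrB /fr; ring.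
have itv t := truncn_itv (mulr_ge0 (ltW TR) (fr0 t)).
have := itv (z i * x1%:R); have := itv (z i * x2%:R).
rewrite -/(cell _) -/(cell _) cE => /andP[l2 u2] /andP[l1 u1].
rewrite -div1r ler_pdivlMr// -[X in _ * X](gtr0_norm TR) -normrM mulrC mulrBr.
by rewrite ler_norml; move: l1 u1 l2 u2; rewrite -natr1; lra.
Qed.

Lemma lambda_hat_vec1_ge (R : realType) (k : nat) (z : 'I_k -> R) :
  (0 < k)%N -> (((k%:R)^-1)%:E <= lambda_hat_vec 1 z)%E.
Proof.
move=> k0; have kR : 0 < k%:R^-1 :> R by rewrite invr_gt0 ltr0n.
apply: (lee_fin_lt kR) => eta /andP[eta0 etak].
apply: ereal_sup_ubound; exists eta => //=.
pose d := k%:R^-1 - eta; have d0 : 0 < d by rewrite subr_gt0.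
have l2 : 0 < ln 2 :> R by rewrite ln_gt0// ltr1n.
(* Beyond this threshold [2 * X^eta <= X^(1/k)]; the factor 2 pays for truncating [U] to the integer
   [T]. *)
exists (expR (ln 2 / d)) => X XX.
have X0 : 0 < X by apply: lt_le_trans XX; rewrite expR_gt0.
have lnX : ln 2 <= ln X * d.
  by rewrite -ler_pdivrMr// -[leLHS]expRK ler_ln// posrE expR_gt0.
have lnX0 : 0 < ln X by rewrite -(pmulr_lgt0 _ d0); exact: lt_le_trans lnX.
pose U := X `^ (k%:R^-1).
have UE : U = expR (k%:R^-1 * ln X) by rewrite /U powR_expR.
have UX : 2 * X `^ eta <= U.
  rewrite UE powR_expR// -[2](@lnK _ 2) ?posrE// -expRD ler_expR.
  by move: lnX; rewrite /d; lra.
have Xe1 : 1 <= X `^ eta.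
  by rewrite powR_expR// -expR0 ler_expR mulr_ge0// ltW.
pose T := Num.truncn U.
have U0 : 0 <= U by rewrite UE expR_ge0.
have /andP[TU UT] := truncn_itv U0.
have TX : X `^ eta <= T%:R by move: UT; rewrite -natr1 -/T; lra.
have T0 : (0 < T)%N by rewrite -(ltr0n R); apply: lt_le_trans TX; lra.
have Tn : (T ^ k <= Num.truncn X)%N.
  rewrite truncn_ge_nat ?(ltW X0)// natrX; apply: (@le_trans _ _ (U ^+ k)).
    by apply: lerXn2r; rewrite ?nnegrE.
  rewrite UE -expRM_natl mulrA divff ?pnatr_eq0 -?lt0n// mul1r.
  by rewrite lnK ?posrE.
have [x [y [x0 xn Hx]]] := dirichlet_approximation z T0 Tn.
exists (fun _ => x%:Z), (fun _ i => y i); split.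
  move=> _; split.
    rewrite ger0_norm ?ler0n//; apply: (@le_trans _ _ (Num.truncn X)%:R).
      by rewrite ler_nat.
    by rewrite truncn_le ltW.
  move=> i; apply: (le_trans (Hx i)).
  by rewrite powRN lef_pV2 ?posrE// (lt_le_trans _ Xe1, lt_le_trans _ TX)// (lt_le_trans _ Xe1).
rewrite rank_rV; case: eqP => // /matrixP/(_ ord0 (lshift k ord0)).
by rewrite row_mxEl !mxE => /eqP; rewrite intr_eq0 => /eqP[] xe; rewrite xe in x0.
Qed.

(** * Reduced fractions and the upper bound for the first uniform exponent *)

(** If [x = q^h x'] and [q^(h+1)] does not divide [x], then [(p/q)^(h+1) x = p^(h+1) x' / q] is a
    fraction over [q] that is not an integer. *)
Lemma coprime_dist_pow (R : realType) (k p q : nat) (x : int) :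
  (0 < q)%N -> coprime p q -> x != 0 -> (`|x| < q ^ k)%N ->
  exists i : 'I_k, forall y : int,
    q%:R^-1 <= `|(p%:R / q%:R) ^+ i.+1 * x%:~R - y%:~R| :> R.
Proof.
move=> q0 pq x0 xq.
have ex : exists h, ~~ (q ^ h %| `|x|)%N.
  by exists k; apply/negP => /dvdn_leq; rewrite absz_gt0 x0 leqNgt xq => /(_ isT).
case: (ex_minnP ex) => -[|h] ndvd hmin; first by rewrite expn0 dvd1n in ndvd.
have hk : (h < k)%N.
  apply: hmin; apply/negP => /dvdn_leq; rewrite absz_gt0 x0 leqNgt xq.
  by move=> /(_ isT).
exists (Ordinal hk) => y /=.
have : (q ^ h %| `|x|)%N.
  by apply/negPn/negP => /hmin; rewrite ltnn.
move=> dv; have : ((q ^ h)%N%:Z %| x)%Z by rewrite dvdzE.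
case/dvdzP => x' xE.
have qR : 0 < q%:R :> R by rewrite ltr0n.
rewrite -[leLHS]div1r ler_pdivrMr// -[X in _ <= _ * X](gtr0_norm qR) -normrM.
have -> : ((p%:R / q%:R) ^+ h.+1 * x%:~R - y%:~R) * q%:R =
    ((p ^ h.+1)%N%:Z * x' - y * q%:Z)%:~R :> R.
  rewrite xE intrB !intrM expr_div_n -![(Posz _)%:~R]/(_%:R) !natrX !exprS.
  by field; rewrite ?expf_neq0 ?gt_eqF.
rewrite -intr_norm ler1z -gtz0_ge1 normr_gt0 subr_eq0.
apply/negP => /eqP E.
have : (q%:Z %| (p ^ h.+1)%N%:Z * x')%Z by rewrite E dvdz_mull.
rewrite Gauss_dvdzr; last by rewrite coprimezE /= coprimeXr// coprime_sym.
move=> qx; have : ((q ^ h.+1)%N%:Z %| x)%Z.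
  by rewrite xE expnS PoszM; exact: dvdz_mul.
by rewrite dvdzE /= (negPf ndvd).
Qed.

(** With [M = r N] the sum is [(P r + 1) / (r N)]. The numerator is prime to [r], so at most a
    factor [N] cancels and [q >= r > N^C]. *)
Lemma gap_fraction_reduced (R : realType) (N M P C : nat) :
  (0 < N)%N -> (N %| M)%N -> (N ^ C.+1 < M)%N ->
  exists p q : nat, [/\ coprime p q, (N ^ C < q)%N, (q <= M)%N &
    p%:R / q%:R = P%:R / N%:R + M%:R^-1 :> R].
Proof.
move=> N0 /dvdnP[r ->] NM.
have r0 : (0 < r)%N by case: r NM.
pose Q := (P * r + 1)%N; pose g := gcdn Q (r * N).
have g0 : (0 < g)%N by rewrite gcdn_gt0 /Q addn1.
have gQ : (g %| Q)%N by exact: dvdn_gcdl.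
have gM : (g %| r * N)%N by exact: dvdn_gcdr.
have gN : (g <= N)%N.
  apply: dvdn_leq => //; rewrite -(Gauss_dvdr _ (_ : coprime g r))//.
  apply: coprime_dvdl gQ _.
  by rewrite /Q coprime_sym /coprime gcdnMDl gcdn1.
exists (Q %/ g)%N, (r * N %/ g)%N.
have q0 : (0 < r * N %/ g)%N by rewrite divn_gt0// dvdn_leq// muln_gt0 r0.
split.
- by rewrite /coprime -(eqn_pmul2r g0) muln_gcdl !divnK// mul1n.
- rewrite expnSr ltn_pmul2r// in NM; apply: (leq_trans NM).
  by rewrite leq_divRL// leq_pmul2l.
- exact: leq_div.
have gR : g%:R != 0 :> R by rewrite pnatr_eq0 -lt0n.
have qR : (r * N %/ g)%:R != 0 :> R by rewrite pnatr_eq0 -lt0n.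
have NR : N%:R != 0 :> R by rewrite pnatr_eq0 -lt0n.
have rR : r%:R != 0 :> R by rewrite pnatr_eq0 -lt0n.
have -> : P%:R / N%:R + (r * N)%:R^-1 = Q%:R / (r * N)%:R :> R.
  by rewrite /Q natrD !natrM; field; rewrite NR rR.
rewrite -{2}(divnK gQ) -{2}(divnK gM) !natrM.
by field; rewrite gR qR.
Qed.

Lemma lambda_hat1_le (R : realType) (k : nat) (zeta : R) :
  (0 < k)%N -> zeta <= 2 -> gap_approximable k zeta ->
  (lambda_hat k 1 zeta <= (k%:R^-1)%:E)%E.
Proof.
move=> k0 z2 gap; apply: ge_ereal_sup => _ [eta /= [X0 HX] <-]; rewrite lee_fin.
have kR : 0 < k%:R :> R by rewrite ltr0n.
rewrite leNgt; apply/negP => eta_gt.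
have keta : 0 < eta * k%:R - 1 by rewrite subr_gt0 -ltr_pdivrMr// div1r.
have eta0 : 0 < eta by apply: lt_trans eta_gt; rewrite invr_gt0.
(* With [X = q^k / D], replacing [zeta] by [p/q] costs at most [c * (2 / L) * X = q^k / (2 L)],
   hence at most [1 / (2 q)]. *)
pose c : R := k%:R * 2 ^+ k; pose D : R := 4 * c.
have c1 : 1 <= c by rewrite -[1]mulr1 ler_pM// ?ler1n// exprn_ege1// ler1n.
have D1 : 1 < D by rewrite /D; lra.
have D0 : 0 < D by exact: lt_trans D1.
(* [ln q >= B] forces [X^(-eta) < 1 / (2 q)], the other half of the forbidden distance [1 / q]. *)
pose B := (ln 2 + eta * ln D + 1) / (eta * k%:R - 1).
pose C := Num.bound (Num.max (expR B) (D * X0)).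
have : Num.max (expR B) (D * X0) < 2 ^+ C by apply: upper_nthrootP.
rewrite gt_max => /andP[BC XC].
(* One extra power of [N] is requested because reducing the fraction may lose it. *)
have [N [M [L [P [N1 NdM NM ML /andP[gz zg]]]]]] := gap C.+1.
have N0 : (0 < N)%N by exact: ltnW.
have M0 : (0 < M)%N by exact: leq_ltn_trans NM.
have [p [q [pq Cq qM pqE]]] := gap_fraction_reduced R P N0 NdM NM.
rewrite -pqE in gz zg.
have q0 : (0 < q)%N by exact: leq_ltn_trans Cq.
have qR : 0 < q%:R :> R by rewrite ltr0n.
have L0R : 0 < L%:R :> R by rewrite ltr0n (leq_ltn_trans _ ML).
have C2q : 2 ^+ C <= q%:R :> R.
  apply: (@le_trans _ _ (N%:R ^+ C)).
    by apply: lerXn2r; rewrite ?nnegrE// ler_nat.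
  by rewrite -natrX ler_nat ltnW.
have lnq : ln 2 + eta * ln D + 1 <= ln q%:R * (eta * k%:R - 1).
  rewrite -ler_pdivrMr// -/B -[B]expRK ler_ln ?posrE ?expR_gt0//.
  exact: le_trans (ltW BC) C2q.
pose X := q%:R ^+ k / D.
have X00 : 0 < X by rewrite divr_gt0// exprn_gt0.
have XX0 : X0 <= X.
  rewrite ler_pdivlMr// mulrC; apply: (le_trans (ltW XC)); apply: (le_trans C2q).
  by rewrite -natrX ler_nat -{1}(expn1 q) leq_pexp2l.
have small : X `^ (- eta) < (2 * q%:R)^-1.
  rewrite powR_expR// lnM ?posrE ?invr_gt0 ?exprn_gt0// lnV ?posrE// lnXn//.
  rewrite -[ltRHS](@lnK _ (2 * q%:R)^-1) ?posrE ?invr_gt0 ?mulr_gt0//.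
  rewrite ltr_expR lnV ?posrE ?mulr_gt0// [ln (2 * _)]lnM ?posrE//.
  by rewrite -[_ *+ k]mulr_natl; move: lnq; clear; lra.
have small1 : X `^ (- eta) < 1.
  apply: (lt_trans small); rewrite invf_lt1 ?mulr_gt0//.
  by rewrite -natrM ltr1n (@leq_pmulr 2).
have [x [y [sol rk]]] := HX X XX0.
have [xX ey] := sol ord0.
(* If [x] vanished, each [y] would be an integer below 1 in absolute value, hence 0, against rank
   1. *)
have x0 : x ord0 != 0.
  apply/eqP => x0; move: rk; rewrite (_ : row_mx _ _ = 0) ?mxrank0//.
  apply/matrixP => r j; rewrite !mxE ord1; case: fintype.splitP => j' _; rewrite !mxE.
    by rewrite x0.
  have := le_lt_trans (ey j') small1.
  rewrite x0 mulr0 sub0r normrN -intr_norm ltrz1 => h.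
  by have -> : y ord0 j' = 0 by move: h; clear; lia.
have xq : (`|x ord0| < q ^ k)%N.
  rewrite -(ltr_nat R) natr_absz intr_norm natrX; apply: (le_lt_trans xX).
  by rewrite ltr_pdivrMr// ltr_pMr// exprn_gt0.
have [i Hi] := coprime_dist_pow R q0 pq x0 xq.
have := Hi (y ord0 i); set g := p%:R / q%:R in gz zg *.
have g0 : 0 <= g by rewrite divr_ge0.
rewrite leNgt => /negP; apply.
have -> : g ^+ i.+1 * (x ord0)%:~R - (y ord0 i)%:~R =
  (zeta ^+ i.+1 * (x ord0)%:~R - (y ord0 i)%:~R) -
  (zeta ^+ i.+1 - g ^+ i.+1) * (x ord0)%:~R by ring.
apply: (le_lt_trans (ler_normB _ _)).
rewrite [ltRHS](_ : _ = (2 * q%:R)^-1 + (2 * q%:R)^-1); last by field; rewrite gt_eqF.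
apply: ltr_leD; first exact: le_lt_trans (ey i) small.
rewrite normrM ger0_norm; last first.
  by rewrite subr_ge0; apply: lerXn2r; rewrite ?nnegrE// (le_trans g0).
apply: (@le_trans _ _ ((c * (2 / L%:R)) * X)).
  apply: ler_pM => //.
    by rewrite subr_ge0; apply: lerXn2r; rewrite ?nnegrE// (le_trans g0).
  apply: (le_trans (subrXX_le g0 gz z2 (ltn_ord i))); apply: ler_wpM2l.
    by rewrite (le_trans _ c1).
  by rewrite lerBlDl.
have -> : c * (2 / L%:R) * X = q%:R ^+ k / (2 * L%:R).
  by rewrite /X /D; field; rewrite !gt_eqF// (lt_le_trans ltr01 c1).
rewrite ler_pdivrMr ?mulr_gt0// mulrC ler_pdivlMr ?mulr_gt0//.
rewrite mulrCA ler_pM2l// -exprSr -natrX ler_nat.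
by apply: leq_trans (ltnW ML); rewrite leq_exp2r.
Qed.

(** * Vanishing of the later uniform exponents *)

(** At [eta = 0] errors up to 1 are allowed, so the vector of floors with [x = 1] and the unit
    vectors with [x = 0] are solutions for all [X >= 1]. *)
Lemma lambda_hat_vec_ge0 (R : realType) (k j : nat) (z : 'I_k -> R) :
  (j <= k.+1)%N -> (0 <= lambda_hat_vec j z)%E.
Proof.
move=> jk; apply: ereal_sup_ubound; exists 0 => //=; exists 1 => X X1.
exists (fun r => (r == 0%N :> nat)%:Z),
  (fun r i => if r == 0%N :> nat then Num.floor (z i) else (r == i.+1 :> nat)%:Z).
split.
  move=> r; split; first by case: eqP => _; rewrite ?normr1 ?normr0// (le_trans _ X1).
  move=> i; rewrite oppr0 powRr0.
  have [_|_] := eqVneq (r : nat) 0%N; last first.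
    rewrite mulr0 sub0r normrN; case: eqP => _; by rewrite ?normr1 ?normr0.
  rewrite mulr1 ger0_norm ?subr_ge0 ?floor_le_tmp// ltW//.
  by rewrite ltrBlDl -[1]/(1%:~R) -intrD floorD1_gt.
set V := row_mx _ _.
apply: (@mxrank_colsub_unit _ _ _ (widen_ord jk : 'I_j -> 'I_(1 + k))).
have VE (r c : 'I_j) : (c <= r)%N ->
    colsub (widen_ord jk : 'I_j -> 'I_(1 + k)) V r c = (c == r)%:R.
  move=> cr; rewrite !mxE; case: fintype.splitP => c' /= ce; rewrite !mxE.
    have c0 : c = 0%N :> nat by rewrite ce ord1.
    by rewrite -val_eqE /= c0 eq_sym; case: eqP.
  rewrite -val_eqE /= ce add1n [in RHS]eq_sym.
  by case: eqP => // r0; rewrite r0 ce in cr.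
rewrite unitmxE -det_tr det_trig.
  by rewrite unitfE; apply/prodf_neq0 => i _; rewrite mxE VE// eqxx oner_eq0.
apply/is_trig_mxP => i a ia; rewrite mxE VE; last exact: ltnW.
by rewrite -val_eqE /= ltn_eqF.
Qed.

(** Multiplying by [N^k] turns the difference into an integer of absolute value below 1. *)
Lemma eq_of_dist_lt (R : realType) (k h N P : nat) (x y : int) :
  (0 < N)%N -> (h <= k)%N ->
  `|(P%:R / N%:R) ^+ h * x%:~R - y%:~R| < (N%:R ^+ k)^-1 :> R ->
  y%:~R = (P%:R / N%:R) ^+ h * x%:~R :> R.
Proof.
move=> N0 hk H; have NR : 0 < N%:R :> R by rewrite ltr0n.
have NkR : 0 < N%:R ^+ k :> R by rewrite exprn_gt0.
move: H; rewrite -[ltRHS]div1r ltr_pdivlMr// -[X in _ * X < _](gtr0_norm NkR) -normrM.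
have -> : ((P%:R / N%:R) ^+ h * x%:~R - y%:~R) * N%:R ^+ k =
    ((P ^ h * N ^ (k - h))%N%:Z * x - y * (N ^ k)%N%:Z)%:~R :> R.
  rewrite intrB !intrM -![(Posz _)%:~R]/(_%:R) natrM !natrX expr_div_n.
  rewrite -(subnK hk) addnK exprD.
  by field; rewrite ?expf_neq0 ?gt_eqF.
rewrite -intr_norm ltrz1 => lt1.
move: lt1; set t := (_ - _ : int) => lt1.
have : t = 0 by move: (t) lt1; clear; lia.
move=> /(congr1 (fun t : int => t%:~R : R)); rewrite /t.
rewrite intrB !intrM -![(Posz _)%:~R]/(_%:R) natrM !natrX /= => /subr0_eq E.
apply: (mulIf (lt0r_neq0 NkR)); rewrite -E expr_div_n -{1}(subnK hk) addnK.
rewrite -[in RHS](subnK hk) exprD.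
by field; rewrite ?expf_neq0 ?gt_eqF.
Qed.

Lemma lambda_hat_le0 (R : realType) (k m : nat) (zeta : R) :
  zeta <= 2 -> gap_approximable k zeta ->
  (lambda_hat k m.+2 zeta <= 0)%E.
Proof.
move=> z2 gap; apply: ge_ereal_sup => _ [eta /= [X0 HX] <-]; rewrite lee_fin.
rewrite leNgt; apply/negP => eta0.
(* For [X = N^e], [e * eta > k + 1] gives [X^(-eta) < 1 / (2 N^k)], and [e > X0] gives [X >= X0]. *)
pose e := (Num.truncn (Num.max (k.+1%:R / eta) X0)).+1.
have : Num.max (k.+1%:R / eta) X0 < e%:R by exact: truncnS_gt.
rewrite gt_max ltr_pdivrMr// => /andP[ke X0e].
pose c : R := k%:R * 2 ^+ k.
have c0 : 0 <= c by rewrite mulr_ge0// exprn_ge0.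
(* As [zeta - f <= 3 / M], replacing [zeta] by [f] costs at most [1 / (2 N^k)] once
   [6 c N^(e+k) <= M]. *)
pose C1 := Num.bound (6 * c).
have cC : 6 * c < 2 ^+ C1 by apply: upper_nthrootP.
have [N [M [L [P [N1 NdM NM ML /andP[gz zg]]]]]] := gap (C1 + (e + k))%N.
have N0 : (0 < N)%N by exact: ltnW.
have M0 : (0 < M)%N by exact: leq_ltn_trans NM.
have NR : 0 < N%:R :> R by rewrite ltr0n.
have MR : 0 < M%:R :> R by rewrite ltr0n.
have L0R : 0 < L%:R :> R by rewrite ltr0n (leq_ltn_trans _ ML).
have NkR : 0 < N%:R ^+ k :> R by rewrite exprn_gt0.
set f := P%:R / N%:R in gz zg; have f0 : 0 <= f by rewrite divr_ge0.
have iM0 : 0 < M%:R^-1 :> R by rewrite invr_gt0.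
have fz : f <= zeta by apply: le_trans gz; rewrite lerDl ltW.
have zf : zeta - f <= 3 / M%:R.
  have : L%:R^-1 <= M%:R^-1 :> R.
    rewrite lef_pV2 ?posrE// ler_nat; apply: leq_trans (ltnW ML).
    by rewrite -{1}(expn1 M) leq_pexp2l.
  by move: zg; clear; lra.
pose X : R := N%:R ^+ e.
have X00 : 0 < X by rewrite exprn_gt0.
have XX0 : X0 <= X.
  apply: (le_trans (ltW X0e)); rewrite /X -natrX ler_nat.
  exact/ltnW/ltn_expl.
have [x [y [sol rk]]] := HX X XX0.
have small : X `^ (- eta) < (2 * N%:R ^+ k)^-1.
  have l2N : ln 2 <= ln N%:R :> R by rewrite ler_ln ?posrE// ler_nat.
  have l20 : 0 < ln 2 :> R by rewrite ln_gt0// ltr1n.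
  rewrite powR_expR// lnXn//.
  rewrite -[ltRHS](@lnK _ (2 * N%:R ^+ k)^-1) ?posrE ?invr_gt0 ?mulr_gt0//.
  rewrite ltr_expR lnV ?posrE ?mulr_gt0// [ln (2 * _)]lnM ?posrE// lnXn//.
  rewrite -[_ *+ e]mulr_natl -[_ *+ k]mulr_natl.
  have : k.+1%:R * ln N%:R < e%:R * eta * ln N%:R.
    by rewrite ltr_pM2r// (lt_le_trans l20).
  by rewrite -(natr1 k); move: l2N; clear; lra.
have yE r (i : 'I_k) : (y r i)%:~R = f ^+ i.+1 * (x r)%:~R :> R.
  apply: (@eq_of_dist_lt _ k) => //; rewrite -/f.
  have [xX ey] := sol r.
  have -> : f ^+ i.+1 * (x r)%:~R - (y r i)%:~R =
    (zeta ^+ i.+1 * (x r)%:~R - (y r i)%:~R) -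
    (zeta ^+ i.+1 - f ^+ i.+1) * (x r)%:~R by ring.
  apply: (le_lt_trans (ler_normB _ _)).
  rewrite [ltRHS](_ : _ = (2 * N%:R ^+ k)^-1 + (2 * N%:R ^+ k)^-1); last first.
    by field; rewrite gt_eqF.
  apply: ltr_leD; first exact: le_lt_trans (ey i) small.
  have dz0 : 0 <= zeta ^+ i.+1 - f ^+ i.+1.
    by rewrite subr_ge0; apply: lerXn2r; rewrite ?nnegrE// (le_trans f0).
  rewrite normrM ger0_norm//.
  apply: (@le_trans _ _ ((c * (3 / M%:R)) * X)).
    apply: ler_pM => //.
    by apply: (le_trans (subrXX_le f0 fz z2 (ltn_ord i))); apply: ler_wpM2l.
  have -> : c * (3 / M%:R) * X = (6 * c) * X / (2 * M%:R).
    by field; rewrite gt_eqF.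
  rewrite ler_pdivrMr ?mulr_gt0// [leRHS]mulrC ler_pdivlMr ?mulr_gt0//.
  rewrite mulrCA ler_pM2l//.
  apply: (@le_trans _ _ ((N ^ (C1 + (e + k)))%:R)); last by rewrite ler_nat ltnW.
  rewrite natrX !exprD -/X -(mulrA (6 * c)); apply: ler_wpM2r; first by rewrite mulr_ge0 ?ltW.
  by apply: (le_trans (ltW cC)); apply: lerXn2r; rewrite ?nnegrE// ler_nat.
move: rk; set V := row_mx _ _.
(* A column times a row has rank at most 1, less than [m.+2]. *)
have -> : V = (\col_r (x r)%:~R) *m (\row_(c < 1 + k) f ^+ c).
  apply/matrixP => r j; rewrite !mxE big_ord1 !mxE.
  case: fintype.splitP => j' ->; rewrite !mxE; first by rewrite ord1 expr0 mulr1.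
  by rewrite yE add1n mulrC.
move=> rk; have := leq_trans (mxrankM_maxl _ _) (rank_leq_col (\col_r ((x r)%:~R : R))).
by move=> /(_ _ (\row_(c < 1 + k) f ^+ c)); rewrite rk.
Qed.

(** * Tail of the series and its gap approximations *)

(** A proper multiple of [q l] is at least [2 * q l], so [s m + 2 / q m] is nonincreasing and bounds
    all later partial sums. *)
Lemma zeta_of_bounds (R : realType) (q : nat -> nat) (n : nat) :
  (forall l, (1 <= l)%N -> (0 < q l)%N) ->
  (forall l, (1 <= l)%N -> (q l %| q l.+1)%N /\ (q l < q l.+1)%N) ->
  (1 <= n)%N ->
  let s := \sum_(1 <= l < n) ((q l)%:R : R)^-1 in
  s <= zeta_of q <= s + 2 / (q n)%:R.
Proof.
move=> q0 qdiv n1; pose s n : R := \sum_(1 <= l < n) ((q l)%:R)^-1.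
rewrite /= -/(s n).
have qR l : (1 <= l)%N -> 0 < (q l)%:R :> R by move=> l1; rewrite ltr0n q0.
have sS m : (1 <= m)%N -> s m.+1 = s m + (q m)%:R^-1.
  by move=> m1; rewrite /s big_nat_recr.
have s0 m : 0 <= s m by apply: sumr_ge0 => i _; rewrite invr_ge0.
have snd : {homo s : a b / (a <= b)%N >-> a <= b}.
  apply/nondecreasing_seqP => -[|m].
    by rewrite {1}/s big_geq.
  by rewrite (sS m.+1)// lerDl invr_ge0.
have decr m p : (1 <= m)%N -> (m <= p)%N ->
    s p + 2 / (q p)%:R <= s m + 2 / (q m)%:R.
  move=> m1 /subnK <-; elim: (p - m)%N => [|d IH]; first by rewrite add0n.
  apply: le_trans IH; rewrite addSn; set l := (d + m)%N.
  have l1 : (1 <= l)%N by rewrite (leq_trans m1)// leq_addl.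
  rewrite sS// -addrA lerD2l.
  have [/dvdnP[t qt] lt] := qdiv l l1.
  have : ((q l * 2)%N%:R <= (q l.+1)%:R :> R).
    rewrite qt -[X in (X < _)%N]mul1n ltn_pmul2r ?q0// in lt.
    by rewrite ler_nat qt mulnC leq_pmul2r ?q0.
  rewrite natrM => ql.
  have : 2 / (q l.+1)%:R <= (q l)%:R^-1 :> R.
    by rewrite ler_pdivrMr ?qR// mulrC ler_pdivlMr ?qR// mulrC.
  by clear; lra.
have bnd m p : (1 <= m)%N -> (m <= p)%N -> s p <= s m + 2 / (q m)%:R.
  by move=> m1 mp; apply: le_trans (decr _ _ m1 mp); rewrite lerDl divr_ge0.
have cvgs : cvgn s.
  apply: nondecreasing_is_cvgn => //.
  exists (s 1%N + 2 / (q 1%N)%:R) => _ [[|m] _ <-]; last exact: bnd.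
  by rewrite {1}/s big_geq// addr_ge0// divr_ge0.
rewrite /zeta_of -/s; apply/andP; split; first exact: nondecreasing_cvgn_le.
apply: limr_le => //; near=> m; apply: bnd => //.
by near: m; exact: nbhs_infty_ge.
Unshelve. all: by end_near.
Qed.

Lemma partial_sum_fraction (R : realType) (q : nat -> nat) (n : nat) :
  (forall l, (1 <= l)%N -> (0 < q l)%N) ->
  (forall l, (1 <= l)%N -> (q l %| q l.+1)%N) ->
  (1 <= n)%N ->
  exists P : nat, \sum_(1 <= l < n.+1) ((q l)%:R : R)^-1 = P%:R / (q n)%:R.
Proof.
move=> q0 qdiv; elim: n => // -[_ _|n IH _].
  by exists 1%N; rewrite big_nat1 div1r.
have [//|P PE] := IH; have /dvdnP[t qt] := qdiv n.+1 isT.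
exists (P * t + 1)%N; rewrite big_nat_recr//= PE.
have := q0 n.+2 isT; have := q0 n.+1 isT.
rewrite qt muln_gt0 !lt0n => q1 /andP[t0 _].
by rewrite natrD !natrM; field; rewrite !pnatr_eq0 q1 t0.
Qed.

Lemma zeta_of_gap_approximable (R : realType) (k : nat) (q : nat -> nat) :
  (forall l, (1 <= l)%N -> (0 < q l)%N) ->
  (forall l, (1 <= l)%N -> (q l %| q l.+1)%N /\ (q l < q l.+1)%N) ->
  (forall C : R, 0 < C -> exists n : nat, (1 <= n)%N /\
       ln ((q n.+1)%:R : R) / ln ((q n)%:R) > C /\
       ln ((q n.+2)%:R : R) / ln ((q n.+1)%:R) > k.+1%:R) ->
  gap_approximable k (zeta_of q : R).
Proof.
move=> q0 qdiv qgap C.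
(* [C] may be 0, while the hypothesis takes a positive constant. *)
have [n [n1 [gapC gapk]]] := qgap C.+1%:R (ltr0Sn R C).
have qR l : (1 <= l)%N -> 0 < (q l)%:R :> R by move=> l1; rewrite ltr0n q0.
have lnq0 l : (1 <= l)%N -> 0 <= ln (q l)%:R :> R.
  by move=> l1; rewrite ln_ge0// ler1n q0.
have lnq l (c : nat) : (1 <= l)%N ->
    c%:R < ln (q l.+1)%:R / ln (q l)%:R :> R -> (1 < q l)%N /\ (q l ^ c < q l.+1)%N.
  move=> l1 lt.
  have lnl : 0 < ln (q l)%:R :> R.
    (* Division by zero yields 0, so a quotient above [c >= 0] excludes [ln (q l) = 0]. *)
    rewrite lt_def lnq0// andbT; apply/eqP => ln0.
    by move: lt; rewrite ln0 invr0 mulr0 ltNge ler0n.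
  split.
    rewrite ltnNge; apply/negP => ql; move: lnl.
    have -> : q l = 1%N by apply/eqP; rewrite eqn_leq ql q0.
    by rewrite ln1 ltxx.
  move: lt; rewrite ltr_pdivlMr// mulr_natl -lnXn ?qR//.
  by rewrite ltr_ln ?posrE ?exprn_gt0 ?qR// -natrX ltr_nat.
have [qn1 gapC'] := lnq _ _ n1 gapC.
have [_ gapk'] := lnq _ _ (ltn0Sn n) gapk.
have [P PE] := @partial_sum_fraction R q n q0 (fun l l1 => (qdiv l l1).1) n1.
exists (q n), (q n.+1), (q n.+2), P; split => //.
- by have [] := qdiv n n1.
- apply: ltn_trans gapC'; rewrite ltn_exp2l//.
have := @zeta_of_bounds R q n.+2 q0 qdiv isT.
by rewrite /= big_nat_recr//= PE.
Qed.

(** * Assembly of the bounds for all exponents *)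

Theorem theorem7 (R : realType) (k : nat) (q : nat -> nat) :
  (0 < k)%N ->
  (forall l, (1 <= l)%N -> (0 < q l)%N) ->
  (forall l, (1 <= l)%N -> (q l %| q l.+1)%N /\ (q l < q l.+1)%N) ->
  (forall C : R, 0 < C -> exists n : nat, (1 <= n)%N /\
       ln ((q n.+1)%:R : R) / ln ((q n)%:R) > C /\
       ln ((q n.+2)%:R : R) / ln ((q n.+1)%:R) > k.+1%:R) ->
  let zeta : R := @zeta_of R q in
  (forall j : nat, (1 <= j <= k.+1)%N ->
     @lambda R k j zeta = (if j == 1%N then +oo%E else ((j.-1)%:R^-1 : R)%:E)) /\
  @lambda_hat R k 1 zeta = ((k%:R)^-1 : R)%:E /\
  (forall j : nat, (2 <= j <= k.+1)%N -> @lambda_hat R k j zeta = 0%E).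
Proof.
move=> k0 q0 qdiv qgap zeta.
have gap : gap_approximable k zeta by exact: zeta_of_gap_approximable.
have z2 : zeta <= 2.
  (* At index 1 the partial sum is empty, leaving [zeta <= 2 / q 1]. *)
  have /= /andP[_] := @zeta_of_bounds R q 1 q0 qdiv isT.
  rewrite big_geq// add0r => /le_trans; apply.
  by rewrite ler_pdivrMr ?ltr0n ?q0// ler_peMr// ler1n q0.
have lambda_ge i eta : (i <= k)%N -> 0 <= eta -> eta * i%:R < 1 ->
    (eta%:E <= lambda k i.+1 zeta)%E.
  move=> ik eta0 etai; apply: ereal_sup_ubound; exists eta => //= X0.
  exact: sol_cond_jet.
split; [|split].
- case=> [//|[_|i]] /=.
    (* For [j = 1] the constraint reads [eta * 0 < 1], so every nonnegative [eta] is admissible. *)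
    apply/eqyP => A A0; apply: lambda_ge => //; first exact: ltW.
    by rewrite mulr0.
  rewrite ltnS => ik; apply/eqP; rewrite eq_le lambda_vec_le//=.
  have i0 : 0 < i.+1%:R^-1 :> R by rewrite invr_gt0.
  apply: (lee_fin_lt i0) => eta /andP[eta0 etai].
  by apply: lambda_ge; rewrite // -ltr_pdivlMr// div1r.
- by apply/eqP; rewrite eq_le lambda_hat1_le//= lambda_hat_vec1_ge.
- case=> [|[|m]]// /andP[_ mk].
  by apply/eqP; rewrite eq_le lambda_hat_le0//= lambda_hat_vec_ge0.
Qed.
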